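(* Let $I \subseteq (0,\infty)$ be an interval with interior $I^{\circ}$, let $f : I^{\circ} \to (0,\infty)$ be differentiable on $I^{\circ}$, and let $a,b \in I^{\circ}$ with $a<b$ and $f' \in L_1[a,b]$. Let $1<p<\infty$ and let $q$ satisfy $\frac1p+\frac1q=1$. Suppose that $|f'|^q$ is geometrically convex and monotonically decreasing on $[a,b]$. Let $x\in[a,b]$ be such that $|f'(x)|\neq|f'(a)|$ and $|f'(x)|\neq|f'(b)|$. Then $$\left| \frac{(b-x)f(b)+(x-a)f(a)}{b-a}-\frac{1}{b-a}\int_a^b f(u)\,du\right| \le \frac{1}{(p+1)^{1/p}}\left\{ \frac{(x-a)^2}{b-a}\Big[L\big(|f'(x)|^q,|f'(a)|^q\big)\Big]^{1/q} + \frac{(b-x)^2}{b-a}\Big[L\big(|f'(x)|^q,|f'(b)|^q\big)\Big]^{1/q}\right\}.$$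
   Context: A function $g : J \to (0,\infty)$ on an interval $J\subset(0,\infty)$ is geometrically convex if $g(y^{t}z^{1-t}) \le [g(y)]^{t}[g(z)]^{1-t}$ for all $y,z\in J$ and $t\in[0,1]$; in particular its values are positive. ''Monotonically decreasing'' means non-increasing. For nonzero reals $u,v$ with $|u|\ne|v|$, the logarithmic mean is $L(u,v)=\dfrac{u-v}{\ln|u|-\ln|v|}$. *)

(* Defs.v *)
From HB Require Import structures.
From mathcomp Require Export all_boot all_order all_algebra.
From mathcomp Require Export all_classical all_reals all_analysis.
Export Order.TTheory GRing.Theory Num.Theory.
Export numFieldNormedType.Exports.

Set Implicit Arguments.
Unset Strict Implicit.
Unset Printing Implicit Defensive.


Local Open Scope ring_scope.

(* Meant for J contained in ]0, +oo[: powR takes junk values at negative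
   bases.  Positivity of g is part of the definition because g is a total
   function here, standing for a map J -> ]0, +oo[. *)
Definition geometrically_convex {R : realType} (J : interval R) (g : R -> R) :=
  {in J, forall y, 0 < g y} /\
  {in J &, forall y z, forall t, t \in `[0, 1] ->
    g (y `^ t * z `^ (1 - t)) <= g y `^ t * g z `^ (1 - t)}.

(* The logarithmic mean; meaningful for u, v nonzero with `|u| != `|v|. *)
Definition logmean {R : realType} (u v : R) : R :=
  (u - v) / (ln `|u| - ln `|v|).

(* Main.v *)
(* On each side e = a, b of x, integrate [s * f'(x + s (e - x))] by parts over
   [0, 1].  Weighted AM-GM, monotonicity and geometric convexity give
   [|f'(x + s (e - x))|^q <= (|f'(e)|^q)^s (|f'(x)|^q)^(1-s)], whose right-hand
   side integrates over [0, 1] to the logarithmic mean, and Hoelder's inequality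
   yields the bound.  Instead of integrating, we compare derivatives: Young's
   inequality, scaled so that it becomes Hoelder's once integrated, bounds the
   derivative of the by-parts primitive by that of an explicit function. *)
From mathcomp Require Import ring lra.
Require Import Defs.

Local Open Scope ring_scope.
Local Open Scope classical_set_scope.

(** * Young's inequality and calculus on an interval *)

(** Young's inequality with the conjugate exponents [1 / t] and [1 / (1 - t)]. *)
Lemma weighted_amgm (R : realType) (x y t : R) : 0 < x -> 0 < y -> 0 < t < 1 ->
  x `^ t * y `^ (1 - t) <= t * x + (1 - t) * y.
Proof.
move=> x0 y0 /andP[t0 t1].
have s0 : 0 < 1 - t by rewrite subr_gt0.
have := @conjugate_powR _ (x `^ t) (y `^ (1 - t)) t^-1 (1 - t)^-1
  (powR_ge0 _ _) (powR_ge0 _ _).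
rewrite !invr_gt0 !invrK -!powRrM !mulfV ?gt_eqF//.
rewrite !powRr1 ?(ltW x0) ?(ltW y0)//.
by move=> /(_ t0 s0); rewrite subrKC (mulrC x) (mulrC y); exact.
Qed.

Lemma conjugate_exponent_gt0 (R : realType) (p q : R) :
  1 < p -> 1 / p + 1 / q = 1 -> 0 < q.
Proof.
move=> p1 pq; have p0 : 0 < p by exact: lt_trans p1.
have pV1 : p^-1 < 1 by rewrite invf_lt1.
by rewrite -invr_gt0; lra.
Qed.

(** The derivatives [dg + df] and [dg - df] are nonnegative, so by the mean value theorem both sums
    of increments are too. This stands in for integrating the bound on [df]. *)
Lemma is_derive_increment_le (R : realType) (f g df dg : R -> R) (a b : R) :
  a < b ->
  (forall x, x \in `]a, b[%R -> is_derive x 1 f (df x)) ->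
  (forall x, x \in `]a, b[%R -> is_derive x 1 g (dg x)) ->
  {within `[a, b], continuous f} -> {within `[a, b], continuous g} ->
  (forall x, x \in `]a, b[%R -> `|df x| <= dg x) ->
  `|f b - f a| <= g b - g a.
Proof.
move=> ab dfE dgE cf cg dfg; rewrite ler_norml; apply/andP; split.
  have [||c cab] := @MVT _ (g \+ f) (dg \+ df) _ _ ab.
  - by move=> x xab; have := dfE _ xab; have := dgE _ xab; exact: is_deriveD.
  - by apply: within_continuousD.
  - rewrite /= => E; rewrite -subr_ge0.
    rewrite (_ : _ - _ = g b + f b - (g a + f a)); last by ring.
    rewrite E mulr_ge0 ?subr_ge0 ?(ltW ab)//.
    have := dfg _ cab; rewrite ler_norml => /andP[+ _]; lra.
have [||c cab] := @MVT _ (g \- f) (dg \- df) _ _ ab.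
- by move=> x xab; have := dfE _ xab; have := dgE _ xab; exact: is_deriveB.
- by apply: within_continuousB.
- rewrite /= => E; rewrite -subr_ge0.
  rewrite (_ : _ - _ = g b - f b - (g a - f a)); last by ring.
  rewrite E mulr_ge0 ?subr_ge0 ?(ltW ab)//.
  have := dfg _ cab; rewrite ler_norml => /andP[_]; lra.
Qed.

(** The derivative rule for powers covers positive bases only; at 0 continuity comes from the
    one-sided limit, where [0 < r] matters. *)
Lemma within_continuous_powR (R : realType) (r : R) : 0 < r ->
  {within `[0, 1], continuous (@powR R ^~ r)}.
Proof.
move=> r0; apply/continuous_within_itvP => //.
have cP : forall x : R, 0 < x -> {for x, continuous (@powR R ^~ r)}.
  move=> x x0; apply: differentiable_continuous; apply/derivable1_diffP.
  by apply: derivable_powR; rewrite in_itv/= andbT.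
split.
- by move=> x; rewrite in_itv/= => /andP[x0 _]; exact: cP.
- by rewrite powR0 ?gt_eqF//; exact: powR_cvg0.
- by apply: cvg_at_left_filter; exact: cP.
Qed.

(** * The logarithmic mean and the bound on the unit interval *)

Lemma logmean_gt0 (R : realType) (u v : R) : 0 < u -> 0 < v -> u != v ->
  0 < logmean u v.
Proof.
move=> u0 v0; rewrite /logmean !gtr0_norm// neq_lt => /orP[uv|vu].
  by rewrite -mulrNN -invrN !opprB divr_gt0// subr_gt0// ltr_ln.
by rewrite divr_gt0// subr_gt0// ltr_ln.
Qed.

(** The path is [expR] of an affine function of [s] whose slope [ln v - ln u] is nonzero. The
    primitive increases over [0, 1] by exactly [logmean u v]. *)
Lemma geometric_path_primitive (R : realType) (u v s : R) :
  0 < u -> 0 < v -> u != v ->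
  is_derive s 1
    (fun s => expR (ln u + s * (ln v - ln u)) / (ln v - ln u))
    (v `^ s * u `^ (1 - s)).
Proof.
move=> u0 v0 uv.
have l0 : ln v - ln u != 0.
  rewrite subr_eq0; apply: contra uv => /eqP/ln_inj; rewrite !posrE => ->//.
have d1 : is_derive s 1 (fun s => ln u + s * (ln v - ln u)) (ln v - ln u).
  by apply: is_derive_eq; rewrite scaler0 !add0r mul1r /GRing.scale/= mulr1.
have d2 : is_derive s 1 (fun s => expR (ln u + s * (ln v - ln u))) _ :=
  @is_derive1_comp _ expR _ _ _ _ (is_derive_expR _) d1.
apply: is_derive_eq.
rewrite !scaler0 add0r /GRing.scale/= /powR !gt_eqF// -expRD.
rewrite mulrCA mulVf// mulr1; congr expR; ring.
Qed.

(* By parts, the left-hand side is [|\int_0^1 s g'(s) ds|]. *)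
Lemma endpoint_remainder_le (R : realType) (g G dg : R -> R) (D E X p q : R) :
  1 < p -> 1 / p + 1 / q = 1 -> 0 < E -> 0 < X -> X != E -> 0 <= D ->
  (forall s : R, s \in `]0, 1[%R -> is_derive s 1 g (dg s)) ->
  (forall s : R, s \in `]0, 1[%R -> is_derive s 1 G (g s)) ->
  {within `[0, 1], continuous g} -> {within `[0, 1], continuous G} ->
  (forall s : R, s \in `]0, 1[%R ->
    `|dg s| <= D * (E `^ s * X `^ (1 - s)) `^ (1 / q)) ->
  `|g 1 - (G 1 - G 0)|
    <= D * (1 / (p + 1) `^ (1 / p) * logmean X E `^ (1 / q)).
Proof.
move=> p1 pq E0 X0 XE D0 dgE dGE cg cG dgle.
have p0 : 0 < p by exact: lt_trans p1.
have q0 := conjugate_exponent_gt0 _ _ _ p1 pq.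
have pq' : p^-1 + q^-1 = 1 by rewrite -pq !div1r.
set L := logmean X E.
have L0 : 0 < L by exact: logmean_gt0.
have pL0 : 0 < (p + 1) * L by rewrite mulr_gt0// addr_gt0.
(* Scaling factor for which the integrated Young inequality is as strong as
   Hoelder's. *)
set al := ((p + 1) * L) `^ (1 / p / q).
have al0 : 0 < al by rewrite powR_gt0.
have alp : al `^ p = ((p + 1) * L) `^ (1 / q).
  by rewrite -powRrM; congr (_ `^ _); field; rewrite !gt_eqF.
have alq : al `^ q = ((p + 1) * L) `^ (1 / p).
  by rewrite -powRrM; congr (_ `^ _); field; rewrite !gt_eqF.
pose K s : R := expR (ln X + s * (ln E - ln X)) / (ln E - ln X).
(* [dW] is [D] times the Young bound for the product of [al * s] and the [1 / q]-th power of the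
   geometric path divided by [al]; [W] is its primitive. *)
pose W s : R := D * (al `^ p / (p * (p + 1)) * s `^ (p + 1)
                     + (q * al `^ q)^-1 * K s).
pose dW s : R := D * (al `^ p / p * s `^ p
                      + (q * al `^ q)^-1 * (E `^ s * X `^ (1 - s))).
have dK (s : R) : is_derive s 1 K (E `^ s * X `^ (1 - s)).
  by apply: geometric_path_primitive.
have K10 : K 1 - K 0 = L.
  rewrite /K mul1r mul0r addr0 subrKC !lnK ?posrE// -mulrBl.
  by rewrite /L /logmean !gtr0_norm// -mulrNN -invrN !opprB.
have W10 : W 1 - W 0 = D * (1 / (p + 1) `^ (1 / p) * L `^ (1 / q)).
  rewrite /W -mulrBr powR1 powR0 ?gt_eqF ?addr_gt0// mulr0 add0r mulr1 -addrA.
  rewrite -mulrBr K10 alp alq; congr (D * _).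
  have LE : L = ((p + 1) * L) `^ (1 / p) * ((p + 1) * L) `^ (1 / q) / (p + 1).
    rewrite -powRD ?pq ?oner_eq0// powRr1 ?ltW// mulrC mulKf//.
    by rewrite gt_eqF// addr_gt0.
  have pE : p + 1 = (p + 1) `^ (1 / p) * (p + 1) `^ (1 / q).
    by rewrite -powRD ?pq ?oner_eq0// powRr1// ltW// addr_gt0.
  have Zp : ((p + 1) * L) `^ (1 / p) != 0 by rewrite gt_eqF// powR_gt0.
  have Pp : (p + 1) `^ (1 / p) != 0 by rewrite gt_eqF// powR_gt0// addr_gt0.
  have Pq : (p + 1) `^ (1 / q) != 0 by rewrite gt_eqF// powR_gt0// addr_gt0.
  (* With this [al] the two Young terms are one common value weighted by [1 / p] and [1 / q], so
     [pq] collapses their sum. *)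
  transitivity (((p + 1) * L) `^ (1 / q) / (p + 1) * (1 / p + 1 / q)).
    rewrite [X in _ + X](congr1 (GRing.mul _) LE); field.
    by rewrite Zp !gt_eqF// addr_gt0.
  rewrite pq mulr1 powRM ?ltW ?addr_gt0// [X in _ / X = _]pE; field.
  by rewrite Pp Pq.
rewrite -W10.
(* Integration by parts: the [g s] terms cancel in the derivative of [h], leaving [s * dg s]. *)
pose h s : R := s * g s - G s.
rewrite (_ : g 1 - _ = h 1 - h 0); last by rewrite /h; ring.
apply: (@is_derive_increment_le _ h W (fun s => s * dg s) dW 0 1 ltr01).
- move=> s s01.
  have d1 := dgE _ s01; have d2 := dGE _ s01.
  apply: is_derive_eq.
  by rewrite /GRing.scale/= mulr1 addrK.
- move=> s; rewrite in_itv/= => /andP[s0 s1].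
  have d1 := is_derive1_powR (p + 1) s0.
  apply: is_derive_eq.
  rewrite /dW /GRing.scale/= addrK; congr (D * (_ + _)).
  by field; rewrite !gt_eqF// addr_gt0.
- apply: within_continuousB => // z.
  by apply: continuousM (cg z); apply: continuous_subspaceT => ?; exact: cvg_id.
- have cK : {within `[0, 1], continuous K}.
    by apply: derivable_within_continuous => s _; have [] := dK s.
  have cP : {within `[0, 1], continuous (@powR R ^~ (p + 1))}.
    by apply: within_continuous_powR; rewrite addr_gt0.
  have cC (c : R) (k : R -> R) : {within `[0, 1], continuous k} ->
      {within `[0, 1], continuous (fun s => c * k s)}.
    by move=> ck z; apply: continuousM (ck z); exact: cvg_cst.
  apply: (cC); apply: (@within_continuousD _ _ _ _
    (fun s => al `^ p / (p * (p + 1)) * s `^ (p + 1))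
    (fun s => (q * al `^ q)^-1 * K s)); exact: cC.
- move=> s s01; have := dgle _ s01; move: s01; rewrite in_itv/= => /andP[s0 s1].
  set Y := E `^ s * _ => dgs.
  have Y0 : 0 <= Y by rewrite mulr_ge0 ?powR_ge0.
  rewrite normrM gtr0_norm//.
  apply: (@le_trans _ _ (D * ((al * s) * (Y `^ (1 / q) / al)))).
    rewrite (_ : _ * (_ / _) = s * Y `^ (1 / q)); last by field; rewrite gt_eqF.
    by rewrite mulrCA ler_pM2l.
  rewrite /dW -/Y ler_wpM2l//.
  have alV : al^-1 `^ q = (al `^ q)^-1.
    by rewrite -(powR_inv1 (ltW al0)) -powRrM mulN1r powRN.
  have Ya : (Y `^ (1 / q) / al) `^ q = Y / al `^ q.
    rewrite powRM ?powR_ge0 ?invr_ge0 ?(ltW al0)// -powRrM divfK ?gt_eqF//.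
    by rewrite powRr1// alV.
  have := @conjugate_powR _ (al * s) (Y `^ (1 / q) / al) p q.
  rewrite Ya powRM ?(ltW al0) ?(ltW s0)//.
  rewrite !mulr_ge0 ?invr_ge0 ?powR_ge0 ?(ltW al0) ?(ltW s0)//.
  move=> /(_ isT isT p0 q0 pq') /le_trans; apply.
  rewrite le_eqVlt; apply/orP; left; apply/eqP; field.
  by rewrite !gt_eqF// powR_gt0.
Qed.

(** * Segments in [[a, b]] and geometric convexity *)

(** Serves to compose [f] and its primitive, whose continuity is relative to [[a, b]], with a path
    that may start or end at an endpoint. *)
Lemma within_continuous_comp_within (T U V : topologicalType)
    (A : set T) (B : set U) (f : T -> U) (g : U -> V) :
  f @` A `<=` B -> {within B, continuous g} -> {within A, continuous f} ->
  {within A, continuous (g \o f)}.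
Proof.
move=> AB /subspace_continuousP cg /subspace_continuousP cf.
apply/subspace_continuousP => x Ax.
apply: cvg_trans (cg (f x) (AB _ (imageP f Ax))).
move=> S /(cf x Ax) fS.
have {}fS : \forall y \near x, A y -> B (f y) -> S (g (f y)) by exact: fS.
change (\forall y \near x, A y -> S (g (f y))).
by apply: filterS fS => y + Ay => /(_ Ay); apply; exact/AB/imageP.
Qed.

Lemma segment_subset (R : realType) (a b e x s : R) :
  e \in `[a, b]%R -> x \in `[a, b]%R -> 0 <= s <= 1 ->
  x + s * (e - x) \in `[a, b]%R.
Proof.
rewrite !in_itv/= => /andP[ae eb] /andP[ax xb] /andP[s0 s1].
by apply/andP; split; nra.
Qed.

(** A point strictly between [e] and [x] avoids the endpoints; the derivative of the primitive of
    [f] is given only there. *)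
Lemma segment_subset_oo (R : realType) (a b e x s : R) : e != x ->
  e \in `[a, b]%R -> x \in `[a, b]%R -> 0 < s < 1 ->
  x + s * (e - x) \in `]a, b[%R.
Proof.
rewrite !in_itv/= neq_lt => /orP[]ex /andP[ae eb] /andP[ax xb] /andP[s0 s1];
  by apply/andP; split; nra.
Qed.

(** The segment point is a weighted arithmetic mean, hence at least the geometric mean; as [g] is
    nonincreasing, its value is at most the one that geometric convexity bounds. *)
Lemma geometrically_convex_segment (R : realType) (a b e x s : R) (g : R -> R) :
  0 < a -> geometrically_convex `[a, b]%R g ->
  {in `[a, b]%R &, nonincreasing_fun g} ->
  e \in `[a, b]%R -> x \in `[a, b]%R -> 0 < s < 1 ->
  g (x + s * (e - x)) <= g e `^ s * g x `^ (1 - s).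
Proof.
move=> a0 [_ gc] gd eab xab s01; have /andP[s0 s1] := s01.
have s1' : 0 <= 1 - s by rewrite subr_ge0 ltW.
move: (eab) (xab); rewrite !in_itv/= => /andP[ae eb] /andP[ax xb].
have e0 := lt_le_trans a0 ae; have x0 := lt_le_trans a0 ax.
have b0 := lt_le_trans e0 eb.
apply: le_trans (gc _ _ eab xab s _); last by rewrite in_itv/= !ltW.
(* Writing [a] and [b] as geometric means of themselves places the geometric mean of [e] and [x] in
   [[a, b]], factor by factor. *)
have pw (z : R) : 0 < z -> z = z `^ s * z `^ (1 - s).
  move=> z0; rewrite -powRD; last by rewrite (gt_eqF z0) implybT.
  by rewrite subrKC powRr1// ltW.
have amgm := weighted_amgm _ _ _ _ e0 x0 s01.
apply: gd.
- rewrite in_itv/=; apply/andP; split.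
    by rewrite [leLHS]pw//; apply: ler_pM; rewrite ?powR_ge0//;
      apply: ge0_ler_powR; rewrite ?nnegrE// ltW.
  by rewrite [leRHS]pw//; apply: ler_pM; rewrite ?powR_ge0//;
    apply: ge0_ler_powR; rewrite ?nnegrE// ltW.
- by apply: segment_subset; rewrite // !ltW.
- by apply: le_trans amgm _; rewrite le_eqVlt; apply/orP; left; apply/eqP; ring.
Qed.

(** * Transfer to [[a, b]] and combination of the two sides *)

(** The sign of [e - x] is left free, so that one statement serves both endpoints. *)
Lemma trapezoid_side_le (R : realType) (f F : R -> R) (a b e x p q : R) :
  0 < a -> 1 < p -> 1 / p + 1 / q = 1 ->
  geometrically_convex `[a, b]%R (fun y => `|f^`() y| `^ q) ->
  {in `[a, b]%R &, nonincreasing_fun (fun y => `|f^`() y| `^ q)} ->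
  {in `[a, b]%R, forall y : R, derivable f y 1} ->
  {within `[a, b], continuous F} ->
  {in `]a, b[%R, forall y : R, is_derive y 1 F (f y)} ->
  e \in `[a, b]%R -> x \in `[a, b]%R -> `|f^`() x| != `|f^`() e| ->
  `|(e - x) * f e - (F e - F x)| <=
    (x - e) ^+ 2 * (1 / (p + 1) `^ (1 / p) *
      logmean (`|f^`() x| `^ q) (`|f^`() e| `^ q) `^ (1 / q)).
Proof.
move=> a0 p1 pq gc gd df cF dF eab xab xe.
(* Distinct values of the derivative force distinct points, which allows division by [e - x]. *)
have ex : e != x by apply: contraNneq xe => ->.
have ex0 : e - x != 0 by rewrite subr_eq0.
have q0 := conjugate_exponent_gt0 _ _ _ p1 pq.
have [gpos _] := gc.
pose u s : R := x + s * (e - x).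
have u0 : u 0 = x by rewrite /u mul0r addr0.
have u1 : u 1 = e by rewrite /u mul1r subrKC.
have du (s : R) : is_derive s 1 u (e - x).
  by apply: is_derive_eq; rewrite scaler0 !add0r mul1r /GRing.scale/= mulr1.
have uab : u @` `[0, 1] `<=` `[a, b].
  move=> _ [s + <-]; rewrite /= in_itv/= => s01.
  exact: (segment_subset _ _ _ _ _ _ eab xab).
have uoo (s : R) : s \in `]0, 1[%R -> u s \in `]a, b[%R.
  by rewrite in_itv => s01; exact: segment_subset_oo.
have cu : {within `[0, 1], continuous u}.
  by apply: derivable_within_continuous => s _; have [] := du s.
have cf : {within `[a, b], continuous f} by exact: derivable_within_continuous.
(* Dividing [F] by [e - x] cancels the chain-rule factor, so the derivative in [s] is [f (u s)]. *)
have := @endpoint_remainder_le R (f \o u) (fun s => (e - x)^-1 * F (u s))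
  (fun s => f^`()%classic (u s) * (e - x)) `|e - x|
  (`|f^`() e| `^ q) (`|f^`() x| `^ q) p q p1 pq (gpos _ eab) (gpos _ xab).
have XE : `|f^`() x| `^ q != `|f^`() e| `^ q.
  by apply: contra xe => /eqP/(powR_injective q0) ->//; rewrite nnegrE.
move=> /(_ XE (normr_ge0 _)).
have H1 (s : R) : s \in `]0, 1[%R ->
    is_derive s 1 (f \o u) (f^`()%classic (u s) * (e - x)).
  move=> /uoo/subset_itv_oo_cc us.
  apply: is_derive1_comp; rewrite derive1E; exact/derivableP/df.
have H2 (s : R) : s \in `]0, 1[%R ->
    is_derive s 1 (fun s => (e - x)^-1 * F (u s)) ((f \o u) s).
  move=> /uoo us; have dFu := is_derive1_comp (dF _ us) (du s).
  have dFu' : is_derive s 1 (fun s => F (u s)) _ := dFu.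
  by apply: is_derive_eq; rewrite /GRing.scale/= mulrCA mulVf// mulr1.
have H3 : {within `[0, 1], continuous (f \o u)}.
  exact: within_continuous_comp_within cf cu.
have H4 : {within `[0, 1], continuous (fun s => (e - x)^-1 * F (u s))}.
  have cFu := within_continuous_comp_within _ _ _ _ _ _ _ uab cF cu.
  by move=> z; apply: continuousM (cFu z); exact: cvg_cst.
move=> /(_ H1 H2 H3 H4).
rewrite /= u0 u1 => side.
have /side {}side : forall s : R, s \in `]0, 1[%R ->
    `|f^`()%classic (u s) * (e - x)| <=
    `|e - x| *
    ((`|f^`() e| `^ q) `^ s * (`|f^`() x| `^ q) `^ (1 - s)) `^ (1 / q).
  move=> s; rewrite in_itv/= => s01.
  rewrite normrM mulrC ler_wpM2l//.
  have -> : `|f^`()%classic (u s)| = (`|f^`()%classic (u s)| `^ q) `^ (1 / q).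
    by rewrite -powRrM mul1r mulfV ?gt_eqF// powRr1.
  apply: ge0_ler_powR.
  - by rewrite divr_ge0// ltW.
  - by rewrite nnegrE powR_ge0.
  - by rewrite nnegrE mulr_ge0 ?powR_ge0.
  exact: (geometrically_convex_segment _ _ _ _ _ _ _ a0 gc gd eab xab).
(* One factor of the square is pulled out here; the other is [D], from the chain rule for [f]. *)
rewrite (_ : _ - _ =
    (e - x) * (f e - ((e - x)^-1 * F e - (e - x)^-1 * F x))).
  rewrite (_ : (x - e) ^+ 2 = `|e - x| * `|e - x|).
    by rewrite normrM -(mulrA `|e - x|) ler_wpM2l.
  by rewrite -normrM -expr2 ger0_norm ?sqr_ge0// -sqrrN opprB.
by field.
Qed.

Theorem theorem4 (R : realType) (I : set R) (f : R -> R) (a b p q x : R)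
  (I_itv : is_interval I)
  (I_pos : I `<=` [set y | 0 < y])
  (f_pos : forall y : R, I° y -> 0 < f y)
  (f_der : forall y : R, I° y -> derivable f y 1)
  (Ia : I° a) (Ib : I° b) (ab : a < b)
  (f'_L1 : (@lebesgue_measure R).-integrable `[a, b] (EFin \o f^`()))
  (p_gt1 : 1 < p)
  (pq : 1 / p + 1 / q = 1)
  (f'_gc : geometrically_convex `[a, b]%R (fun y => `|f^`() y| `^ q))
  (f'_decr : {in `[a, b]%R &, nonincreasing_fun (fun y => `|f^`() y| `^ q)})
  (xab : x \in `[a, b]%R)
  (xa : `|f^`() x| != `|f^`() a|)
  (xb : `|f^`() x| != `|f^`() b|) :
  `| ((b - x) * f b + (x - a) * f a) / (b - a)
     - 1 / (b - a) * (\int[@lebesgue_measure R]_(u in `[a, b]) f u) |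
  <= 1 / (p + 1) `^ (1 / p) *
     ((x - a) ^+ 2 / (b - a) *
        logmean (`|f^`() x| `^ q) (`|f^`() a| `^ q) `^ (1 / q)
      + (b - x) ^+ 2 / (b - a) *
        logmean (`|f^`() x| `^ q) (`|f^`() b| `^ q) `^ (1 / q)).
Proof.
have a0 : 0 < a by apply: I_pos; exact: interior_subset.
have ba0 : 0 < b - a by rewrite subr_gt0.
have df : {in `[a, b]%R, forall y : R, derivable f y 1}.
  move=> y; rewrite in_itv/= => yab; apply: f_der.
  have [<-//|ay] := eqVneq a y; have [->//|yb] := eqVneq y b.
  (* An open subset of [I] lies in its interior, so only the endpoints rest on [Ia] and [Ib]. *)
  have sub : `]a, b[%classic `<=` I°.
    rewrite -open_subsetE; last exact: interval_open.
    move=> z; rewrite /= in_itv/= => /andP[az zb].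
    apply: (I_itv _ _ (interior_subset Ia) (interior_subset Ib)).
    by rewrite !ltW.
  by apply: sub; rewrite /= in_itv/= !lt_neqAle ay yb.
have cf : {within `[a, b], continuous f} by exact: derivable_within_continuous.
have intf : (@lebesgue_measure R).-integrable `[a, b] (EFin \o f).
  by apply: continuous_compact_integrable => //; exact: segment_compact.
pose F y : R := \int[@lebesgue_measure R]_(t in `[a, y]) f t.
have cF : {within `[a, b], continuous F}.
  by apply: parameterized_integral_continuous => //; exact: ltW.
have dF : {in `]a, b[%R, forall y : R, is_derive y 1 F (f y)}.
  move=> y yab; have := yab; rewrite in_itv/= => /andP[ay yb].
  have cfy : {for y, continuous f}.
    apply: differentiable_continuous; apply/derivable1_diffP; apply: df.
    exact: subset_itv_oo_cc.
  have [//|dFy <-] := continuous_FTC1 yb intf _ cfy.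
  by rewrite derive1E; exact/derivableP.
have Fa : F a = 0 by rewrite /F set_itv1 Rintegral_set1.
have aab : a \in `[a, b]%R by rewrite in_itv/= lexx ltW.
have bab : b \in `[a, b]%R by rewrite in_itv/= lexx ltW.
have Ha := trapezoid_side_le _ _ _ _ _ _ _ _ _
  a0 p_gt1 pq f'_gc f'_decr df cF dF aab xab xa.
have Hb := trapezoid_side_le _ _ _ _ _ _ _ _ _
  a0 p_gt1 pq f'_gc f'_decr df cF dF bab xab xb.
(* Generalizing the logarithmic means and the constant leaves a purely algebraic combination. *)
suff combine (A B c : R) :
    `|(a - x) * f a - (F a - F x)| <= (x - a) ^+ 2 * (c * A) ->
    `|(b - x) * f b - (F b - F x)| <= (x - b) ^+ 2 * (c * B) ->
    `|((b - x) * f b + (x - a) * f a) / (b - a) - 1 / (b - a) * F b| <=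
    c * ((x - a) ^+ 2 / (b - a) * A + (b - x) ^+ 2 / (b - a) * B).
  exact: combine Ha Hb.
move=> {}Ha {}Hb.
(* Subtracting the two sides cancels [F x], and [F a] is 0. *)
rewrite (_ : _ / _ - _ =
  (((b - x) * f b - (F b - F x)) - ((a - x) * f a - (F a - F x))) / (b - a));
  last by rewrite Fa; field; rewrite gt_eqF.
rewrite (_ : c * _ =
  ((x - b) ^+ 2 * (c * B) + (x - a) ^+ 2 * (c * A)) / (b - a));
  last by field; rewrite gt_eqF.
rewrite normrM normfV (gtr0_norm ba0) ler_pM2r ?invr_gt0//.
exact: le_trans (ler_normB _ _) (lerD Hb Ha).
Qed.
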